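(* For $n$ processors, there exists a protocol solving binary Commit-Adopt against a stationary send-omission $t$-MAd adversary if and only if $t<n$.
   Context: System: $n$ processors run a synchronous round-based protocol; each round every processor sends a (possibly different) message to every processor over dedicated point-to-point channels whose receiver knows the sender identity; messages of round $\rho$ are delivered by the start of round $\rho+1$. A message adversary (MAd) sees all messages; in the send-omission type it may delete any of the outgoing messages of processors it corrupts, and it never alters internal states, inputs, outputs or incoming messages. A stationary $t$-MAd adversary corrupts at most $t$ processors in total throughout the execution. Every processor (corrupted or not) must output and the task conditions apply to all processors. Binary Commit-Adopt: each processor has an input bit and outputs $commit(v)$ or $adopt(v)$ with $v$ some processor's input; if all inputs equal $v$ all output $commit(v)$; if some processor outputs $commit(v)$ then every processor outputs $commit(v)$ or $adopt(v)$.
   Formalization: The equivalence is stated for n ≥ 2 processors: for n = 1 and t ≥ 1 it fails, since the only processor can simply commit its own input although t < n does not hold (and for n = 0 solvability is vacuous). *)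

(* Defs.v *)
From mathcomp Require Import all_boot.
Set Implicit Arguments.
Unset Strict Implicit.
Unset Printing Implicit Defensive.

(* [m i j] is the message that processor [i] sends to processor [j]. *)
Definition sent (n : nat) (M : Type) := 'I_n -> 'I_n -> M.

(* [d i j] is what [j] receives from [i]; [None] means that nothing came. *)
Definition delivered (n : nat) (M : Type) := 'I_n -> 'I_n -> option M.

Inductive ca_output := Commit of bool | Adopt of bool.

Definition ca_value (o : ca_output) : bool :=
  match o with Commit v | Adopt v => v end.

(* The local state is an arbitrary type, so it may record the processor's     *)
(* identity, its input, the round number and everything received so far.      *)
Record protocol (n : nat) := Protocol {
  state : Type;
  msg : Type;
  init : 'I_n -> bool -> state;
  send : state -> 'I_n -> msg;
  recv : state -> ('I_n -> option msg) -> state;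
  output : state -> option ca_output
}.

(* The adversary's choices in a round depend on the messages sent in all the  *)
(* earlier rounds (in chronological order) and on those of the current round. *)
Record message_adversary (n : nat) (M : Type) := MessageAdversary {
  corrupt : seq (sent n M) -> sent n M -> {set 'I_n};
  deliver : seq (sent n M) -> sent n M -> delivered n M
}.

Definition send_omission n M (A : message_adversary n M) : Prop :=
  forall past m i j,
    deliver A past m i j = Some (m i j) \/
    i \in corrupt A past m /\ deliver A past m i j = None.

(* The set [S] bounds the processors corrupted over all rounds together; it   *)
(* may depend on the messages [h], so corruption may be adaptive.             *)
Definition stationary n M (t : nat) (A : message_adversary n M) : Prop :=
  forall h : nat -> sent n M, exists S : {set 'I_n},
    #|S| <= t /\ forall r, corrupt A (mkseq h r) (h r) \subset S.

(* The states after [r] rounds, with the messages sent in these rounds. *)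
Fixpoint run n (P : protocol n) (A : message_adversary n (msg P))
    (x : 'I_n -> bool) (r : nat) : ('I_n -> state P) * seq (sent n (msg P)) :=
  match r with
  | 0 => (fun i => init P i (x i), [::])
  | r'.+1 =>
      let: (s, past) := run A x r' in
      let m := fun i j => send (s i) j in
      let d := deliver A past m in
      (fun j => recv (s j) (fun i => d i j), rcons past m)
  end.

(* An output is irrevocable, so a processor's output is the first one that    *)
(* its state shows; no bound on the number of rounds is imposed.              *)
Definition outputs n (P : protocol n) (A : message_adversary n (msg P))
    (x : 'I_n -> bool) (i : 'I_n) (o : ca_output) : Prop :=
  exists r, output ((run A x r).1 i) = Some o /\
    forall r', r' < r -> output ((run A x r').1 i) = None.

Definition commit_adopt n (x : 'I_n -> bool) (y : 'I_n -> ca_output) : Prop :=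
  [/\ forall i, exists j, ca_value (y i) = x j,
      forall v, (forall i, x i = v) -> forall i, y i = Commit v
    & forall i v, y i = Commit v -> forall j, y j = Commit v \/ y j = Adopt v].

Definition solves_commit_adopt n (t : nat) (P : protocol n) : Prop :=
  forall A : message_adversary n (msg P), send_omission A -> stationary t A ->
  forall x : 'I_n -> bool, exists y : 'I_n -> ca_output,
    (forall i, outputs A x i (y i)) /\ commit_adopt x y.

(* Main.v *)
(* If [t < n], some processor [p] is never corrupted, so every processor hears *)
(* all messages of [p]. First everyone broadcasts its input and proposes a     *)
(* value if this is the only one it hears; as it hears [p], every proposal     *)
(* equals the input of [p], so proposals never conflict. Then everyone         *)
(* broadcasts its proposal (or the lack of one), commits to [v] if it hears    *)
(* nothing but proposals of [v], and adopts any proposal it hears. A commit    *)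
(* implies that [p] proposed [v], which everyone hears. If [n <= t], dropping  *)
(* all messages makes each processor commit to its own input.                  *)
Require Import Defs.
From mathcomp Require Import all_boot.
Set Implicit Arguments.
Unset Strict Implicit.
Unset Printing Implicit Defensive.

(** Both directions turn on whether one processor is heard by all. If [t < n],
    [uncorrupted_processor] gives such a [p], and [two_round_commit_adopt] is a purely combinatorial
    statement about two rounds of deliveries: the input of [p] is the only value that can be
    proposed, committed to, or adopted from a proposal. If [n <= t], total silence is a legal
    adversary, and by [run_silent] a processor cannot tell mixed inputs from unanimous ones, so
    validity forces conflicting commits. *)

Lemma run_recv n (P : protocol n) (A : message_adversary n (msg P)) x r j :
  (run A x r.+1).1 j =
  recv ((run A x r).1 j)
    (fun i => deliver A (run A x r).2
                (fun i' j' => send ((run A x r).1 i') j') i j).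
Proof. by rewrite /=; case: (run A x r). Qed.

Lemma run_past n (P : protocol n) (A : message_adversary n (msg P)) x r :
  (run A x r).2 = mkseq (fun k i j => send ((run A x k).1 i) j) r.
Proof.
elim: r => // r IHr; rewrite -(addn1 r) /mkseq iotaD map_cat -/(mkseq _ r) -IHr.
by rewrite addn1 /= cats1; case: (run A x r).
Qed.

Lemma outputs_inj n (P : protocol n) (A : message_adversary n (msg P)) x i :
  forall o o', outputs A x i o -> outputs A x i o' -> o = o'.
Proof.
move=> o o' [r [or nr]] [r' [or' nr']].
case: (ltngtP r r') => [/nr'|/nr|eq_r]; rewrite ?or ?or' //.
by move: or; rewrite eq_r or' => -[].
Qed.

Lemma uncorrupted_processor n (P : protocol n)
    (A : message_adversary n (msg P)) t x :
  send_omission A -> stationary t A -> t < n ->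
  exists p, forall r j,
    deliver A (run A x r).2 (fun i' j' => send ((run A x r).1 i') j') p j =
    Some (send ((run A x r).1 p) j).
Proof.
move=> omA stA lt_tn.
(* The bounding set depends on the history, so it is taken for the messages this run really sends;
   [run_past] identifies the two. *)
have [S [leSt corrS]] := stA (fun k i j => send ((run A x k).1 i) j).
have /subsetPn[p _ pS] : ~~ ([set: 'I_n] \subset S).
  apply/negP => /subset_leq_card; rewrite cardsT card_ord leqNgt.
  by rewrite (leq_ltn_trans leSt lt_tn).
exists p => r j.
have := corrS r; rewrite -run_past => /subsetP/(_ p) subS.
have [//|[/subS]] := omA (run A x r).2
  (fun i' j' => send ((run A x r).1 i') j') p j.
by rewrite (negPf pS).
Qed.

Section TwoRounds.
Variable n : nat.
Implicit Types (d : 'I_n -> option (option bool)) (v : bool).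

(** The outer [None] is a lost message and is tolerated; [Some None] is a received absence of a
    proposal and blocks the choice. *)
Definition only_value d : option bool :=
  [pick v | [forall i, d i \in [:: None; Some (Some v)]]].

Definition some_value d : option bool :=
  [pick v | [exists i, d i == Some (Some v)]].

Definition decide (b : bool) d : ca_output :=
  if only_value d is Some v then Commit v
  else if some_value d is Some v then Adopt v else Adopt b.

Inductive two_round_state :=
  Started of bool | Proposed of bool & option bool | Decided of ca_output.

Definition two_round_protocol : protocol n :=
  @Protocol n two_round_state (option bool)
    (fun _ b => Started b)
    (fun s _ => match s with
       | Started b => Some b | Proposed _ w => w | Decided _ => None end)
    (fun s d => match s with
       | Started b => Proposed b (only_value d)
       | Proposed b _ => Decided (decide b d)
       | Decided o => Decided o end)
    (fun s => if s is Decided o then Some o else None).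

Lemma only_value_heard d p w v :
  d p = Some w -> only_value d = Some v -> w = Some v.
Proof.
rewrite /only_value => dp; case: pickP => // u /forallP/(_ p).
by rewrite dp !inE => /eqP[->] [->].
Qed.

Lemma only_value_unanimous d p v :
  d p = Some (Some v) -> (forall i, d i = Some (Some v) \/ d i = None) ->
  only_value d = Some v.
Proof.
(* Whatever value [pick] selects, the message from [p] forces it to be [v]. *)
move=> dp dv; case E: (only_value d) => [u|].
  by case: (only_value_heard dp E) => ->.
move: E; rewrite /only_value; case: pickP => // /(_ v) /negP[].
by apply/forallP => i; case: (dv i) => ->; rewrite !inE ?eqxx.
Qed.

Lemma some_value_heard d p v :
  d p = Some (Some v) -> exists u, some_value d = Some u.
Proof.
rewrite /some_value => dp; case: pickP => [u _|/(_ v)/existsP[]].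
  by exists u.
by exists p; rewrite dp.
Qed.

Lemma some_valueP d v : some_value d = Some v -> exists i, d i = Some (Some v).
Proof.
by rewrite /some_value; case: pickP => // u /existsP[i /eqP di] [<-]; exists i.
Qed.

Lemma two_round_commit_adopt (x : 'I_n -> bool) p
    (d1 d2 : 'I_n -> 'I_n -> option (option bool)) :
  (forall i j, d1 j i = Some (Some (x i)) \/ d1 j i = None) ->
  (forall i j, d2 j i = Some (only_value (d1 i)) \/ d2 j i = None) ->
  (forall j, d1 j p = Some (Some (x p))) ->
  (forall j, d2 j p = Some (only_value (d1 p))) ->
  commit_adopt x (fun j => decide (x j) (d2 j)).
Proof.
move=> d1P d2P d1p d2p.
have proposal i v : only_value (d1 i) = Some v -> v = x p.
  by move=> /(only_value_heard (d1p i))[->].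
have only2 j v : only_value (d2 j) = Some v -> only_value (d1 p) = Some v.
  exact: only_value_heard (d2p j).
have some2 j v : some_value (d2 j) = Some v -> v = x p.
  case/some_valueP=> i; case: (d2P i j) => -> // [].
  exact: proposal.
split=> [i|v xv i|i v].
- rewrite /decide; case E: (only_value (d2 i)) => [v|].
    by exists p; apply: (proposal p); apply: only2 E.
  case E': (some_value (d2 i)) => [v|]; last by exists i.
  by exists p; apply: some2 E'.
- have only1 j : only_value (d1 j) = Some v.
    apply: (only_value_unanimous (p := p)) => [|k]; first by rewrite d1p xv.
    by rewrite -(xv k).
  rewrite /decide (only_value_unanimous (p := p) (v := v)) //.
    by rewrite d2p only1.
  by move=> k; rewrite -(only1 k).
- rewrite /decide; case E: (only_value (d2 i)) => [u|]; last first.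
    by case: (some_value _).
  (* A commit to [u] means that [p] proposed [u], hence [u = x p]; as [j] hears this proposal too,
     it cannot fall back on its own input. *)
  case=> <- {v} j; have pu := only2 _ _ E; have ux := proposal _ _ pu.
  case E': (only_value (d2 j)) => [w|].
    by left; rewrite ux (proposal _ _ (only2 _ _ E')).
  have [w Ew] : exists w, some_value (d2 j) = Some w.
    by apply: (@some_value_heard _ p u); rewrite d2p pu.
  by right; rewrite Ew ux (some2 _ _ Ew).
Qed.

Lemma two_round_solves t : t < n -> solves_commit_adopt t two_round_protocol.
Proof.
move=> lt_tn A omA stA x.
have [p hearp] := uncorrupted_processor x omA stA lt_tn.
pose d r j i := deliver A (run A x r).2
  (fun i' j' => send ((run A x r).1 i') j') i j.
have dP r i j : d r j i = Some (send ((run A x r).1 i) j) \/ d r j i = None.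
  by rewrite /d; have [->|[_ ->]] := omA (run A x r).2
    (fun i' j' => send ((run A x r).1 i') j') i j; [left|right].
have st1 j : (run A x 1).1 j = Proposed (x j) (only_value (d 0 j)).
  by rewrite run_recv.
have st2 j : (run A x 2).1 j = Decided (decide (x j) (d 1 j)).
  by rewrite run_recv st1.
exists (fun j => decide (x j) (d 1 j)); split.
  move=> j; exists 2; rewrite st2; split=> // -[//|[_|//]].
  by rewrite st1.
apply: (@two_round_commit_adopt x p (d 0) (d 1)) => [i j|i j|j|j].
- exact: dP 0 i j.
- by have := dP 1 i j; rewrite st1.
- exact: hearp 0 j.
- by have := hearp 1 j; rewrite st1.
Qed.

End TwoRounds.

Definition silent n M : message_adversary n M :=
  MessageAdversary (fun _ _ => [set: 'I_n]) (fun _ _ _ _ => None).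

(** With nothing delivered, a state evolves from the processor's own input alone. *)
Lemma run_silent n (P : protocol n) x x' i r :
  x i = x' i ->
  (run (silent n (msg P)) x r).1 i = (run (silent n (msg P)) x' r).1 i.
Proof.
by move=> eqx; elim: r => [|r IHr]; [rewrite /= eqx | rewrite !run_recv IHr].
Qed.

Lemma outputs_silent n (P : protocol n) x x' i o :
  x i = x' i -> outputs (silent n (msg P)) x i o ->
  outputs (silent n (msg P)) x' i o.
Proof.
move=> eqx [r [or nr]]; exists r; rewrite -(run_silent P r eqx); split=> // r'.
by rewrite -(run_silent P r' eqx); apply: nr.
Qed.

Lemma solvable_ltn n t (P : protocol n) :
  1 < n -> solves_commit_adopt t P -> t < n.
Proof.
move=> n_gt1 solP; rewrite ltnNge; apply/negP => le_nt.
have om : send_omission (silent n (msg P)) by move=> *; right; rewrite inE.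
have st : stationary t (silent n (msg P)).
  by move=> h; exists [set: 'I_n]; rewrite cardsT card_ord.
(* Processor 0 gets [true] and all others [false], so processors 0 and 1 will disagree. *)
pose x (i : 'I_n) := i == 0 :> nat.
have [y [outy [_ _ agree]]] := solP _ om st x.
(* To [i] this run looks like the one where every input is [x i], where it must commit to [x i]. *)
have commit_own i : y i = Commit (x i).
  have [z [outz [_ /(_ (x i) (fun=> erefl)) valid _]]] :=
    solP _ om st (fun=> x i).
  rewrite -(valid i); apply: outputs_inj (outz i).
  exact: outputs_silent (outy i).
by have [] := agree _ _ (commit_own (Ordinal (ltnW n_gt1))) (Ordinal n_gt1);
  rewrite commit_own.
Qed.

Theorem theorem4p4 (n t : nat) (hn : 1 < n) :
  (exists P : protocol n, solves_commit_adopt t P) <-> t < n.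
Proof.
split=> [[P]|lt_tn]; first exact: solvable_ltn.
by exists (two_round_protocol n); apply: two_round_solves.
Qed.
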